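(* For every $n\in\mathbb{N}=\{1,2,3,\dotsc\}$, the Bernoulli number of the second kind $b_n$ satisfies $$b_n=(-1)^{n+1}\int_1^\infty\frac{1}{\{[\ln(t-1)]^2+\pi^2\}\,t^{n}}\,\mathrm{d}t .$$
   Context: The Bernoulli numbers of the second kind $b_n$, $n\ge 0$, are the real numbers defined by the power series expansion (around $x=0$) $\frac{x}{\ln(1+x)}=\sum_{n=0}^\infty b_nx^n$, where the left-hand side is given its limit value $1$ at $x=0$. For example $b_0=1$, $b_1=\frac12$, $b_2=-\frac1{12}$, $b_3=\frac1{24}$. *)

(* Defs.v *)
From Stdlib Require Import Reals Lra Lia List.
From Coquelicot Require Import Coquelicot.
Open Scope R_scope.

Definition x_over_ln1p (x : R) : R :=
  if Req_EM_T x 0 then 1 else x / ln (1 + x).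

Definition is_bernoulli2 (b : nat -> R) : Prop :=
  locally 0 (fun x => is_pseries b x (x_over_ln1p x)).

(* [is_bernoulli2] determines exactly one sequence: [bernoulli2_exists] and
   [bernoulli2_unique] below. *)

Lemma CV_radius_ge (a : nat -> R) (r M : R) :
  (forall n, Rabs (a n * r ^ n) <= M) -> Rbar_le r (CV_radius a).
Proof.
intros H. apply (proj1 (CV_radius_bounded a)). now exists M.
Qed.

Lemma bernoulli2_unique (b c : nat -> R) :
  is_bernoulli2 b -> is_bernoulli2 c -> forall n, b n = c n.
Proof.
assert (Hr : forall a, is_bernoulli2 a -> Rbar_lt 0 (CV_radius a)).
{ intros a [e He].
  assert (He2 : 0 < e / 2) by (generalize (cond_pos e); lra).
  assert (Hb : ball 0 e (e / 2)).
  { unfold ball; simpl; unfold AbsRing_ball, abs, minus, plus, opp; simpl.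
    rewrite Rabs_right; lra. }
  specialize (He _ Hb). apply is_pseries_R in He.
  assert (Hl : is_lim_seq (fun n => a n * (e / 2) ^ n) 0).
  { apply ex_series_lim_0. eexists; exact He. }
  destruct (filterlim_bounded _ (ex_intro _ 0 Hl)) as [M HM].
  apply Rbar_lt_le_trans with (e / 2); [exact He2|].
  apply CV_radius_ge with M. exact HM. }
intros Hb Hc n. apply PSeries_ext_recip; auto.
generalize (filter_and _ _ Hb Hc). apply filter_imp. intros x [H1 H2].
now rewrite (is_pseries_unique _ _ _ H1), (is_pseries_unique _ _ _ H2).
Qed.

Definition ln1p_coef (k : nat) : R := (-1) ^ k / INR (S k).

Lemma ln1p_coef_bound k : Rabs (ln1p_coef k) <= 1.
Proof.
unfold ln1p_coef, Rdiv. rewrite Rabs_mult, pow_1_abs.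
assert (H : 1 <= INR (S k)) by (rewrite S_INR; generalize (pos_INR k); lra).
rewrite Rabs_right.
- rewrite Rmult_1_l, <- Rinv_1. apply Rinv_le_contravar; lra.
- apply Rle_ge, Rlt_le, Rinv_0_lt_compat; lra.
Qed.

Lemma ln1p_coef_radius : Rbar_le 1 (CV_radius ln1p_coef).
Proof.
apply CV_radius_ge with 1. intros n.
rewrite pow1, Rmult_1_r. apply ln1p_coef_bound.
Qed.

Lemma ln1p_PSeries x : Rabs x < 1 -> x * PSeries ln1p_coef x = ln (1 + x).
Proof.
intros Hx.
assert (Hgeo : forall t, Rabs t < 1 -> PSeries (fun k => (-1) ^ k) t = / (1 + t)).
{ intros t Ht. apply is_pseries_unique, is_pseries_R.
  apply is_series_ext with (fun n => (- t) ^ n).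
  - intros n. now rewrite <- Rpow_mult_distr; f_equal; ring.
  - replace (1 + t) with (1 - - t) by ring. apply is_series_geom.
    now rewrite Rabs_Ropp. }
assert (Hin : forall t, Rmin 0 x <= t <= Rmax 0 x -> Rabs t < 1).
{ intros t Ht. apply Rabs_def2 in Hx. apply Rabs_def1;
  revert Ht; unfold Rmin, Rmax; destruct (Rle_dec 0 x); lra. }
assert (H1 : is_RInt (fun t => / (1 + t)) 0 x (PSeries (PS_Int (fun k => (-1) ^ k)) x)).
{ apply is_RInt_ext with (PSeries (fun k => (-1) ^ k)).
  - intros t Ht. apply Hgeo, Hin. lra.
  - apply is_RInt_PSeries. apply Rbar_lt_le_trans with 1; [exact Hx|].
    apply CV_radius_ge with 1. intros n.
    rewrite pow1, Rmult_1_r, pow_1_abs. lra. }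
assert (H2 : is_RInt (fun t => / (1 + t)) 0 x (minus (ln (1 + x)) (ln (1 + 0)))).
{ apply (is_RInt_derive (fun t => ln (1 + t))).
  - intros t Ht. generalize (Rabs_def2 _ _ (Hin t Ht)); intros.
    auto_derive; [lra|field; lra].
  - intros t Ht. generalize (Rabs_def2 _ _ (Hin t Ht)); intros.
    apply (ex_derive_continuous (fun t => / (1 + t))). auto_derive. lra. }
assert (E : PSeries (PS_Int (fun k => (-1) ^ k)) x = ln (1 + x)).
{ rewrite <- (is_RInt_unique _ _ _ _ H1), (is_RInt_unique _ _ _ _ H2).
  unfold minus, plus, opp; simpl. rewrite Rplus_0_r, ln_1. ring. }
rewrite <- E, <- PSeries_incr_1. apply PSeries_ext. intros [|n]; reflexivity.
Qed.

(* [b_n; ...; b_0], from the Cauchy product of [b] and [ln1p_coef] being 1. *)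
Fixpoint bernoulli2_list (n : nat) : list R :=
  match n with
  | O => 1 :: nil
  | S m => let l := bernoulli2_list m in
           (- sum_f_R0 (fun i => ln1p_coef (S i) * nth i l 0) m) :: l
  end.

Definition bernoulli2_rec (n : nat) : R := nth 0 (bernoulli2_list n) 0.

Lemma nth_bernoulli2_list n i : (i <= n)%nat ->
  nth i (bernoulli2_list n) 0 = bernoulli2_rec (n - i).
Proof.
revert i; induction n as [|n IH]; intros [|i] Hi; try reflexivity; try lia.
change (nth (S i) (bernoulli2_list (S n)) 0) with (nth i (bernoulli2_list n) 0).
rewrite IH by lia. reflexivity.
Qed.

Lemma bernoulli2_recS n : bernoulli2_rec (S n) =
  - sum_f_R0 (fun i => ln1p_coef (S i) * bernoulli2_rec (n - i)) n.
Proof.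
unfold bernoulli2_rec at 1; cbn [bernoulli2_list nth]. f_equal.
apply sum_eq. intros i Hi. now rewrite nth_bernoulli2_list.
Qed.

Lemma bernoulli2_rec_bound n : Rabs (bernoulli2_rec n) <= 2 ^ n.
Proof.
induction n as [n IH] using (well_founded_induction Wf_nat.lt_wf).
destruct n as [|n].
- unfold bernoulli2_rec; simpl. rewrite Rabs_R1. lra.
- rewrite bernoulli2_recS, Rabs_Ropp.
  eapply Rle_trans; [apply sum_f_R0_triangle|].
  apply Rle_trans with (sum_f_R0 (fun i => 2 ^ (n - i)) n).
  + apply sum_Rle. intros i Hi. rewrite Rabs_mult.
    rewrite <- (Rmult_1_l (2 ^ (n - i))).
    apply Rmult_le_compat; try apply Rabs_pos; [apply ln1p_coef_bound|].
    apply IH. lia.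
  + assert (H : forall m, sum_f_R0 (fun i => 2 ^ (m - i)) m <= 2 ^ S m).
    { clear. induction m as [|m IHm]; [simpl; lra|].
      rewrite decomp_sum by lia. cbn [pred].
      rewrite (sum_eq _ (fun i => 2 ^ (m - i))) by (intros; f_equal; lia).
      rewrite Nat.sub_0_r. simpl in *. lra. }
    apply H.
Qed.

Lemma bernoulli2_exists : exists b, is_bernoulli2 b.
Proof.
exists bernoulli2_rec.
assert (Rb : Rbar_le (/ 2) (CV_radius bernoulli2_rec)).
{ apply CV_radius_ge with 1. intros n. rewrite Rabs_mult, <- RPow_abs.
  rewrite (Rabs_right (/ 2)) by lra.
  apply Rle_trans with (2 ^ n * (/ 2) ^ n).
  - apply Rmult_le_compat_r; [apply pow_le; lra|apply bernoulli2_rec_bound].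
  - rewrite <- Rpow_mult_distr. replace (2 * / 2) with 1 by field.
    rewrite pow1. lra. }
assert (P : 0 < / 2) by lra.
exists (mkposreal _ P). intros x Hx.
assert (Hx' : Rabs x < / 2).
{ revert Hx. unfold ball; simpl; unfold AbsRing_ball, abs, minus, plus, opp; simpl.
  now rewrite Ropp_0, Rplus_0_r. }
assert (Xa : Rbar_lt (Rabs x) (CV_radius ln1p_coef)).
{ apply Rbar_lt_le_trans with 1; [simpl; lra|apply ln1p_coef_radius]. }
assert (Xb : Rbar_lt (Rabs x) (CV_radius bernoulli2_rec)).
{ apply Rbar_lt_le_trans with (/ 2); [exact Hx'|exact Rb]. }
pose proof (PSeries_correct _ _ (CV_radius_inside _ _ Xa)) as Sa.
pose proof (PSeries_correct _ _ (CV_radius_inside _ _ Xb)) as Sb.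
pose proof (is_pseries_mult _ _ _ _ _ Sa Sb Xa Xb) as Sab.
assert (C : forall n, PS_mult ln1p_coef bernoulli2_rec n =
                      PS_incr_1 (fun _ => 0) n + match n with O => 1 | _ => 0 end).
{ intros [|n]; unfold PS_mult.
  - unfold ln1p_coef, bernoulli2_rec; simpl. unfold zero; simpl. field.
  - rewrite decomp_sum by lia. cbn [pred].
    rewrite Nat.sub_0_r, bernoulli2_recS. unfold ln1p_coef at 1. simpl.
    field. }
assert (U : PSeries ln1p_coef x * PSeries bernoulli2_rec x = 1).
{ rewrite <- (is_pseries_unique _ _ _ Sab).
  rewrite PSeries_decr_1 by (eexists; exact Sab).
  rewrite (PSeries_ext (PS_decr_1 _) (fun _ => 0)).
  - rewrite PSeries_const_0, C. simpl. unfold zero; simpl. ring.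
  - intros n. unfold PS_decr_1. rewrite C. simpl. ring. }
assert (Hx1 : Rabs x < 1) by lra.
replace (x_over_ln1p x) with (PSeries bernoulli2_rec x); [exact Sb|].
unfold x_over_ln1p. destruct (Req_EM_T x 0) as [->|Nx].
- rewrite PSeries_0. reflexivity.
- rewrite <- (ln1p_PSeries x Hx1).
  assert (PSeries ln1p_coef x <> 0) by (intros Z; rewrite Z in U; lra).
  apply Rmult_eq_reg_l with (PSeries ln1p_coef x); [|assumption].
  rewrite U. field. now split.
Qed.

(* Main.v *)
Require Import Defs.
From Stdlib Require Import Reals Lra Lia.
From Coquelicot Require Import Coquelicot.
Open Scope R_scope.

(** With [t = 1 + exp u] the integral becomes the moment
    [I_n = int K(u) exp u / (1 + exp u)^n du], [K(u) = 1 / (u^2 + PI^2)], and a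
    geometric expansion with remainder gives
    [sum (-x)^k I_(k+1) = int K(u) / (1 + exp (a - u)) du] for [a = ln (1 + x)].
    The integrand is [- 1 / PI] times the imaginary part of
    [h(v) = 1 / (v (1 - exp (a - v)))] on the line [Im v = PI]. Shifting this
    line down to the real axis picks up half of each of the residues
    [1 / (1 - exp a)] at [v = 0] and [1 / a] at [v = a], so the integral equals
    [1 / ln (1 + x) - 1 / x]. Hence the [(-1)^(n+1) I_n] are the coefficients of
    [x / ln (1 + x)]. *)

(** * Taylor bounds *)

(** No complex integral is formed. Only the imaginary part of [h] is integrated, over [[- r, r]] at
    height [th]; by the Cauchy-Riemann equations the [th]-derivative of this integral is a
    difference of two boundary values of the real part, of size [O(1 / r)]. The obstacle is the
    limit of [th] to 0, because both poles lie on the limiting line. There [h] is real, so its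
    imaginary part survives only at the poles: a simple pole [v0] with residue [rho] contributes
    [- rho] times the Poisson kernel [th / ((u - v0)^2 + th^2)], whose mass is [PI]. This is why
    each residue counts half. The limit in [th] is taken at fixed [r], and [r] grows afterwards;
    hence the error constants near the axis may depend on [r]. The height [PI] is dictated by [K]:
    the imaginary part of [1 / v] there is [- PI * K(u)], and [exp (a - v)] becomes [- exp (a - u)],
    which gives the logistic factor. *)

Lemma is_derive_cosh (x : R) : is_derive cosh x (sinh x).
Proof. apply is_derive_Reals, derivable_pt_lim_cosh. Qed.

Lemma is_derive_sinh (x : R) : is_derive sinh x (cosh x).
Proof. apply is_derive_Reals, derivable_pt_lim_sinh. Qed.

Lemma le_of_derive_le (f g df dg : R -> R) (x : R) :
  0 <= x -> f 0 <= g 0 ->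
  (forall y, is_derive f y (df y)) -> (forall y, is_derive g y (dg y)) ->
  (forall y, 0 <= y <= x -> df y <= dg y) -> f x <= g x.
Proof.
intros Hx H0 Hf Hg Hd.
assert (D : forall y, is_derive (fun y => g y - f y) y (dg y - df y)).
{ intros y. exact (is_derive_minus g f y _ _ (Hg y) (Hf y)). }
destruct (MVT_gen (fun y => g y - f y) 0 x (fun y => dg y - df y)) as [c [Hc E]].
- intros y _. apply D.
- intros y _. apply derivable_continuous_pt. eexists. apply is_derive_Reals, D.
- rewrite Rmin_left, Rmax_right in Hc by lra.
  specialize (Hd c Hc). assert (0 <= (dg c - df c) * (x - 0)) by (apply Rmult_le_pos; lra).
  lra.
Qed.

Ltac deriv :=
  let y := fresh in intros y;
  first [apply is_derive_sinh | apply is_derive_cosh | auto_derive; auto; try field; try lra].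

(** One Taylor step: equality at 0 and a comparison of derivatives on [[0, x]] give the inequality
    at [x]. Each bound below is obtained by integrating the previous one. *)
Ltac chain f df g dg x :=
  apply (le_of_derive_le f g df dg x);
  [ lra | rewrite ?sin_0, ?cos_0, ?sinh_0, ?cosh_0; lra | deriv | deriv | ].

Lemma sin_le_id (x : R) : 0 <= x -> sin x <= x.
Proof.
intros Hx. chain sin cos (fun y : R => y) (fun _ : R => 1) x.
intros y _. apply COS_bound.
Qed.

Lemma cos_ge_quadratic (x : R) : 0 <= x -> 1 - x ^ 2 / 2 <= cos x.
Proof.
intros Hx. chain (fun y => 1 - y ^ 2 / 2) (fun y => - y) cos (fun y => - sin y) x.
intros y Hy. apply Ropp_le_contravar, sin_le_id. lra.
Qed.

Lemma sin_ge_cubic (x : R) : 0 <= x -> x - x ^ 3 / 6 <= sin x.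
Proof.
intros Hx. chain (fun y => y - y ^ 3 / 6) (fun y => 1 - y ^ 2 / 2) sin cos x.
intros y Hy. apply cos_ge_quadratic. lra.
Qed.

Lemma cos_le_quartic (x : R) : 0 <= x -> cos x <= 1 - x ^ 2 / 2 + x ^ 4 / 24.
Proof.
intros Hx.
chain cos (fun y => - sin y) (fun y => 1 - y ^ 2 / 2 + y ^ 4 / 24)
  (fun y => - (y - y ^ 3 / 6)) x.
intros y Hy. apply Ropp_le_contravar, sin_ge_cubic. lra.
Qed.

Lemma cosh_opp (x : R) : cosh (- x) = cosh x.
Proof. unfold cosh. rewrite Ropp_involutive. lra. Qed.

Lemma sinh_opp (x : R) : sinh (- x) = - sinh x.
Proof. unfold sinh. rewrite Ropp_involutive. lra. Qed.

Lemma cosh_sqr (x : R) : cosh x * cosh x = 1 + sinh x * sinh x.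
Proof.
unfold cosh, sinh. assert (H : exp x * exp (- x) = 1).
{ rewrite <- exp_plus, Rplus_opp_r. apply exp_0. }
nra.
Qed.

Lemma cosh_ge_1 (x : R) : 1 <= cosh x.
Proof. generalize (cosh_sqr x). unfold cosh. generalize (exp_pos x), (exp_pos (- x)). nra. Qed.

Lemma sinh_ge_id (x : R) : 0 <= x -> x <= sinh x.
Proof.
intros Hx. chain (fun y : R => y) (fun _ : R => 1) sinh cosh x.
intros y _. apply cosh_ge_1.
Qed.

Lemma sign_symmetric_ind (P : R -> Prop) :
  (forall x, P x -> P (- x)) -> (forall x, 0 <= x -> P x) -> forall x, P x.
Proof.
intros Hs Hp x. destruct (Rle_or_lt 0 x) as [H|H]; auto.
rewrite <- (Ropp_involutive x). apply Hs, Hp. lra.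
Qed.

Lemma cosh_ge_quadratic (x : R) : 1 + x ^ 2 / 2 <= cosh x.
Proof.
apply (sign_symmetric_ind (fun x => 1 + x ^ 2 / 2 <= cosh x)); clear x.
- intros x. rewrite cosh_opp. replace ((- x) ^ 2) with (x ^ 2) by ring. auto.
- intros x Hx. chain (fun y => 1 + y ^ 2 / 2) (fun y : R => y) cosh sinh x.
  intros y Hy. apply sinh_ge_id. lra.
Qed.

Lemma cosh_le_exp (x y : R) : Rabs y <= x -> cosh y <= exp x.
Proof.
intros H. apply Rabs_le_between in H. unfold cosh.
assert (M : forall z, z <= x -> exp z <= exp x).
{ intros z [Hz|Hz]; [left; now apply exp_increasing|right; now rewrite Hz]. }
generalize (M y ltac:(lra)), (M (- y) ltac:(lra)). lra.
Qed.

(** Integrating [cosh <= exp L] repeatedly gives remainders with factors 1/6 and 1/24, which are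
    then discarded. The cube of [Rabs x] is written [x ^ 2 * Rabs x] so that the two factors can
    later be bounded separately. *)
Lemma sinh_cosh_taylor (L x : R) : Rabs x <= L ->
  Rabs (sinh x - x) <= exp L * x ^ 2 * Rabs x /\
  cosh x - 1 - x ^ 2 / 2 <= exp L * x ^ 4.
Proof.
apply (sign_symmetric_ind (fun x => Rabs x <= L -> Rabs (sinh x - x) <= exp L * x ^ 2 * Rabs x /\
  cosh x - 1 - x ^ 2 / 2 <= exp L * x ^ 4)); clear x.
- intros x H. rewrite Rabs_Ropp, cosh_opp, sinh_opp. intros Hx.
  replace (- sinh x - - x) with (- (sinh x - x)) by ring. rewrite Rabs_Ropp.
  replace ((- x) ^ 2) with (x ^ 2) by ring. replace ((- x) ^ 4) with (x ^ 4) by ring. auto.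
- intros x Hx HL. rewrite Rabs_right in HL by lra. rewrite (Rabs_right x) by lra.
  set (E := exp L).
  assert (HE : 0 < E) by apply exp_pos.
  assert (B1 : forall y, 0 <= y <= L -> cosh y <= E).
  { intros y Hy. apply cosh_le_exp. rewrite Rabs_right; lra. }
  assert (B2 : forall y, 0 <= y <= L -> sinh y <= E * y).
  { intros y Hy. chain sinh cosh (fun y => E * y) (fun _ : R => E) y.
    intros z Hz. apply B1. lra. }
  assert (B3 : forall y, 0 <= y <= L -> cosh y <= 1 + E * y ^ 2 / 2).
  { intros y Hy. chain cosh sinh (fun y => 1 + E * y ^ 2 / 2) (fun y => E * y) y.
    intros z Hz. apply B2. lra. }
  assert (B4 : forall y, 0 <= y <= L -> sinh y <= y + E * y ^ 3 / 6).
  { intros y Hy. chain sinh cosh (fun y => y + E * y ^ 3 / 6) (fun y => 1 + E * y ^ 2 / 2) y.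
    intros z Hz. apply B3. lra. }
  assert (B5 : forall y, 0 <= y <= L -> cosh y <= 1 + y ^ 2 / 2 + E * y ^ 4 / 24).
  { intros y Hy. chain cosh sinh (fun y => 1 + y ^ 2 / 2 + E * y ^ 4 / 24) (fun y => y + E * y ^ 3 / 6) y.
    intros z Hz. apply B4. lra. }
  assert (0 <= E * x ^ 3) by (apply Rmult_le_pos; [lra|apply pow_le; lra]).
  assert (0 <= E * x ^ 4) by (apply Rmult_le_pos; [lra|apply pow_le; lra]).
  specialize (B4 x (conj Hx HL)). specialize (B5 x (conj Hx HL)). split; [|lra].
  rewrite Rabs_right by (generalize (sinh_ge_id x Hx); lra).
  replace (E * x ^ 2 * x) with (E * x ^ 3) by ring. lra.
Qed.

(** * Integrals against the Cauchy density *)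

(** The Cauchy law of scale [PI], of total mass 1: domination by [C * cauchy_density] therefore
    bounds an integral by [C] itself. *)
Definition cauchy_density (u : R) : R := / (u ^ 2 + PI ^ 2).

Lemma cauchy_denominator_pos (u : R) : 0 < u ^ 2 + PI ^ 2.
Proof. generalize PI_RGT_0. nra. Qed.

Lemma cauchy_density_pos (u : R) : 0 < cauchy_density u.
Proof. apply Rinv_0_lt_compat, cauchy_denominator_pos. Qed.

Lemma continuous_cauchy_density (u : R) : continuous cauchy_density u.
Proof.
apply (ex_derive_continuous cauchy_density). unfold cauchy_density.
auto_derive. generalize (cauchy_denominator_pos u). simpl. lra.
Qed.

(** The scale is left free: [c = PI] gives the mass of the Cauchy density, and small [c] gives the
    Poisson kernels that extract the residues. *)
Lemma is_RInt_poisson (c a b : R) : 0 < c ->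
  is_RInt (fun u => c / (u ^ 2 + c ^ 2)) a b (atan (b / c) - atan (a / c)).
Proof.
intros Hc. assert (forall u, 0 < u ^ 2 + c ^ 2) by (intros; nra).
apply (is_RInt_derive (fun u => atan (u / c))).
- intros u _. evar_last.
  + apply (is_derive_comp atan (fun u => u / c)); [apply is_derive_atan|].
    auto_derive; [exact I|reflexivity].
  + specialize (H u). unfold scal; simpl; unfold mult; simpl. unfold Rsqr. field. repeat split; lra || nra.
- intros u _. apply (ex_derive_continuous (fun u => c / (u ^ 2 + c ^ 2))).
  auto_derive. specialize (H u). simpl in H. lra.
Qed.

Lemma continuous_ex_RInt (g : R -> R) (a b : R) :
  (forall u, continuous g u) -> ex_RInt g a b.
Proof. intros H. apply (ex_RInt_continuous (V := R_CompleteNormedModule)). auto. Qed.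

Section CauchyDominated.

Variables (g : R -> R) (C : R).
Hypothesis g_continuous : forall u, continuous g u.
Hypothesis g_dominated : forall u, Rabs (g u) <= C * cauchy_density u.

Lemma dominated_constant_pos : 0 <= C.
Proof.
generalize (g_dominated 0), (Rabs_pos (g 0)), (cauchy_density_pos 0). nra.
Qed.

Lemma RInt_cauchy_dominated (a b : R) : a <= b -> Rabs (RInt g a b) <= C.
Proof.
intros Hab. set (k := fun u => C / PI * (PI / (u ^ 2 + PI ^ 2))).
assert (HP := PI_RGT_0). assert (HC := dominated_constant_pos).
assert (Hk : is_RInt k a b (C / PI * (atan (b / PI) - atan (a / PI)))).
{ apply (is_RInt_scal (V := R_NormedModule)). now apply is_RInt_poisson. }
eapply Rle_trans.
- eapply (norm_RInt_le g k a b); [exact Hab| |apply (RInt_correct (V := R_CompleteNormedModule)), continuous_ex_RInt, g_continuous|exact Hk].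
  intros u _. unfold norm; simpl; unfold abs; simpl. eapply Rle_trans; [apply g_dominated|].
  right. unfold k, cauchy_density. generalize (cauchy_denominator_pos u). intros. field. lra.
- generalize (atan_bound (b / PI)), (atan_bound (a / PI)). intros.
  replace C with (C / PI * PI) at 2 by (field; lra).
  apply Rmult_le_compat_l; [apply Rdiv_le_0_compat; lra|lra].
Qed.

(** Comparison with [C / u ^ 2]. The endpoints are unordered because the Cauchy criterion compares
    arbitrary pairs of truncations. *)
Lemma RInt_cauchy_tail (A a b : R) : 0 < A ->
  (A < a /\ A < b \/ a < - A /\ b < - A) -> Rabs (RInt g a b) <= C / A.
Proof.
intros HA. assert (HC := dominated_constant_pos).
assert (HCA : 0 < / A) by (apply Rinv_0_lt_compat; lra).
assert (G : forall a b, a <= b -> (A < a \/ b < - A) -> Rabs (RInt g a b) <= C / A).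
{ clear a b. intros a b Hab H.
  assert (Hn : forall u, a <= u <= b -> u <> 0) by (intros; lra).
  assert (Hk : is_RInt (fun u => C * / u ^ 2) a b (minus (- C / b) (- C / a))).
  { apply (is_RInt_derive (fun u => - C / u)).
    - rewrite Rmin_left, Rmax_right by lra. intros u Hu. specialize (Hn u Hu).
      auto_derive; [exact Hn|field; exact Hn].
    - rewrite Rmin_left, Rmax_right by lra. intros u Hu. specialize (Hn u Hu).
      apply (ex_derive_continuous (fun u => C * / u ^ 2)). auto_derive.
      generalize (pow_nonzero u 2 Hn). simpl. auto. }
  eapply Rle_trans.
  - eapply (norm_RInt_le g _ a b); [exact Hab| |apply (RInt_correct (V := R_CompleteNormedModule)), continuous_ex_RInt, g_continuous|exact Hk].
    intros u Hu. unfold norm; simpl; unfold abs; simpl. eapply Rle_trans; [apply g_dominated|].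
    apply Rmult_le_compat_l; [lra|]. unfold cauchy_density. specialize (Hn u Hu).
    assert (0 < u ^ 2) by (generalize (pow2_ge_0 u), (pow_nonzero u 2 Hn); lra).
    apply Rinv_le_contravar; [simpl in *; lra|]. generalize (pow2_ge_0 PI). simpl. lra.
  - unfold minus, plus, opp; simpl.
    assert (I : forall x, A < x -> 0 <= / x <= / A).
    { intros x Hx. split; [apply Rlt_le, Rinv_0_lt_compat; lra|apply Rinv_le_contravar; lra]. }
    replace (- C / b + - (- C / a)) with (C * (/ a - / b)) by (unfold Rdiv; field; split; apply Hn; lra).
    apply Rmult_le_compat_l; [lra|].
    destruct H as [H|H].
    + generalize (I a ltac:(lra)), (I b ltac:(lra)). lra.
    + generalize (I (- a) ltac:(lra)), (I (- b) ltac:(lra)).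
      rewrite !Rinv_opp. lra. }
intros H. destruct (Rle_or_lt a b) as [Hab|Hab].
- apply G; lra.
- rewrite <- (opp_RInt_swap g b a) by apply continuous_ex_RInt, g_continuous.
  unfold opp; simpl. rewrite Rabs_Ropp. apply G; lra.
Qed.

Lemma is_RInt_gen_cauchy_dominated :
  exists l, is_RInt_gen g (Rbar_locally m_infty) (Rbar_locally p_infty) l /\ Rabs l <= C.
Proof.
set (F := filter_prod (Rbar_locally m_infty) (Rbar_locally p_infty)).
set (I := fun ab : R * R => RInt g (fst ab) (snd ab)).
assert (HC := dominated_constant_pos).
assert (FF : ProperFilter F) by (apply filter_prod_proper).
assert (E : exists l, filterlim I F (locally l)).
{ apply (filterlim_locally_cauchy (U := R_CompleteSpace)). intros eps.
  (* Two tails of size [C / A] must add up to less than [eps]; the summand 1 keeps [A] positive when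
     [C = 0]. *)
  set (A := (2 * C + 1) / eps).
  assert (HA : 0 < A) by (apply Rdiv_lt_0_compat; [lra|apply cond_pos]).
  exists (fun ab => fst ab < - A /\ A < snd ab). split.
  - apply Filter_prod with (fun a => a < - A) (fun b => A < b);
      [now exists (- A)|now exists A|auto].
  - intros [a b] [a' b'] [Ha Hb] [Ha' Hb']. simpl in *.
    unfold ball; simpl; unfold AbsRing_ball, abs, minus, plus, opp; simpl. unfold I; simpl.
    assert (X : forall x y, ex_RInt g x y) by (intros; apply continuous_ex_RInt, g_continuous).
    assert (Y : RInt g a' b' = RInt g a' a + (RInt g a b + RInt g b b')).
    { rewrite <- (RInt_Chasles g a' a b') by apply X.
      rewrite <- (RInt_Chasles g a b b') by apply X. reflexivity. }
    rewrite Y. replace (_ + - _) with (RInt g a' a + RInt g b b') by ring.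
    eapply Rle_lt_trans; [apply Rabs_triang|].
    assert (T1 : Rabs (RInt g a' a) <= C / A) by (apply RInt_cauchy_tail; lra).
    assert (T2 : Rabs (RInt g b b') <= C / A) by (apply RInt_cauchy_tail; lra).
    apply Rle_lt_trans with (2 * C / A); [lra|].
    unfold A. generalize (cond_pos eps); intros.
    apply Rmult_lt_reg_r with (2 * C + 1); [lra|].
    replace (2 * C / ((2 * C + 1) / eps) * (2 * C + 1)) with (eps * (2 * C)) by (field; lra).
    apply Rmult_lt_compat_l; lra. }
destruct E as [l Hl]. exists l. split.
- apply (filterlimi_lim_ext I); [|exact Hl].
  intros [a b]. apply (RInt_correct (V := R_CompleteNormedModule)), continuous_ex_RInt, g_continuous.
- apply Rnot_lt_le. intros HlC.
  assert (He : 0 < Rabs l - C) by lra.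
  assert (P : F (fun ab => fst ab <= snd ab)).
  { apply Filter_prod with (fun a => a < 0) (fun b => 0 < b); [now exists 0|now exists 0|].
    intros; simpl; lra. }
  specialize (Hl _ (locally_ball l (mkposreal _ He))).
  destruct (filter_ex _ (filter_and _ _ P Hl)) as [[a b] [Hab B]].
  simpl in Hab. apply RInt_cauchy_dominated in Hab.
  revert B. unfold I, ball; simpl; unfold AbsRing_ball, abs, minus, plus, opp; simpl.
  intros B. generalize (Rabs_triang_inv l (RInt g a b)). rewrite Rabs_minus_sym.
  unfold Rminus in *. lra.
Qed.

End CauchyDominated.

(** * Symmetric truncation and exponential substitution *)

Lemma is_RInt_gen_symmetric_lim (g : R -> R) (l : R) :
  (forall u, continuous g u) ->
  is_RInt_gen g (Rbar_locally m_infty) (Rbar_locally p_infty) l ->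
  filterlim (fun r => RInt g (- r) r) (Rbar_locally p_infty) (locally l).
Proof.
intros Hg Hl. intros P HP. destruct (Hl P HP) as [Q S HQ HS H].
destruct HQ as [M HM]. destruct HS as [N HN].
exists (Rmax (- M) N). intros r Hr.
generalize (Rmax_l (- M) N), (Rmax_r (- M) N). intros.
destruct (H (- r) r) as [y [Hy Py]]; [apply HM; lra|apply HN; lra|].
simpl in Hy. now rewrite (is_RInt_unique _ _ _ _ Hy).
Qed.

Lemma is_RInt_gen_subst_exp (f : R -> R) (l : R) :
  (forall t, 1 < t -> continuous f t) ->
  is_RInt_gen (fun u => exp u * f (1 + exp u)) (Rbar_locally m_infty) (Rbar_locally p_infty) l ->
  is_RInt_gen f (at_right 1) (Rbar_locally p_infty) l.
Proof.
intros Hf Hl.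
(* The inverse of the substitution [t = 1 + exp u]: it carries the endpoints 1 and infinity to minus
   and plus infinity. *)
set (phi := fun p => ln (p - 1)).
assert (L1 : filterlim phi (at_right 1) (Rbar_locally m_infty)).
{ apply (filterlim_comp _ _ _ (fun p => p - 1) ln _ (at_right 0)); [|apply is_lim_ln_0].
  intros P [d Hd]. exists d. intros y Hy Hy1. apply Hd; [|lra].
  revert Hy. unfold ball; simpl; unfold AbsRing_ball, abs, minus, plus, opp; simpl.
  now replace (y - 1 + - 0) with (y + - 1) by ring. }
assert (L2 : filterlim phi (Rbar_locally p_infty) (Rbar_locally p_infty)).
{ apply (filterlim_comp _ _ _ (fun p => p - 1) ln _ (Rbar_locally p_infty)); [|apply is_lim_ln_p].
  intros P [M HM]. exists (M + 1). intros y Hy. apply HM. lra. }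
assert (L : filterlimi (fun ab => is_RInt (fun u => exp u * f (1 + exp u)) (phi (fst ab)) (phi (snd ab)))
  (filter_prod (at_right 1) (Rbar_locally p_infty)) (locally l)).
{ apply (filterlimi_comp_2 (fun ab => phi (fst ab)) (fun ab => phi (snd ab))
    (fun a b => is_RInt (fun u => exp u * f (1 + exp u)) a b)) with (3 := Hl).
  - eapply filterlim_comp; [apply filterlim_fst|exact L1].
  - eapply filterlim_comp; [apply filterlim_snd|exact L2]. }
refine (filterlimi_ext_loc _ _ _ L).
apply Filter_prod with (fun a => 1 < a) (fun b => 1 < b).
- exists (mkposreal 1 Rlt_0_1). auto.
- now exists 1.
- intros a b Ha Hb y. simpl.
  assert (S : is_RInt (fun u => exp u * f (1 + exp u)) (phi a) (phi b) (RInt f a b)).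
  { assert (Ex : forall p, 1 < p -> p = 1 + exp (phi p)).
    { intros p Hp. unfold phi. rewrite exp_ln; lra. }
    rewrite (Ex a) at 2 by assumption. rewrite (Ex b) at 2 by assumption.
    apply (is_RInt_comp f (fun u => 1 + exp u) exp).
    - intros u _. apply Hf. generalize (exp_pos u). lra.
    - intros u _. split; [auto_derive; [exact I|ring]|].
      apply (ex_derive_continuous exp). auto_derive. exact I. }
  assert (T : is_RInt f a b (RInt f a b)).
  { apply (RInt_correct (V := R_CompleteNormedModule)), (ex_RInt_continuous (V := R_CompleteNormedModule)). intros z Hz. apply Hf.
    revert Hz. unfold Rmin. destruct (Rle_dec a b); lra. }
  split; intros H.
  + rewrite <- (is_RInt_unique _ _ _ _ H), (is_RInt_unique _ _ _ _ S). exact T.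
  + rewrite <- (is_RInt_unique _ _ _ _ H). exact S.
Qed.

(** * Shifting the line of integration *)

(* Real and imaginary parts of [coth (w / 2) / 2] at [w = p + i th], and of its
   derivative. *)
Definition coth_den (p th : R) : R := cosh p - cos th.
Definition half_coth_re (p th : R) : R := sinh p / (2 * coth_den p th).
Definition half_coth_im (p th : R) : R := - sin th / (2 * coth_den p th).
Definition half_coth_re' (p th : R) : R :=
  (1 - cosh p * cos th) / (2 * coth_den p th ^ 2).
Definition half_coth_im' (p th : R) : R :=
  sin th * sinh p / (2 * coth_den p th ^ 2).

(** The poles of the half cotangent are the multiples of [2 i PI], so this open strip contains none;
    in real terms, [1 - cos th] is twice the square of [sin (th / 2)]. *)
Lemma coth_den_pos (p th : R) : 0 < th < 2 * PI -> 0 < coth_den p th.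
Proof.
intros H. unfold coth_den. generalize (cosh_ge_1 p). intros.
assert (0 < sin (th / 2)) by (apply sin_gt_0; lra).
replace th with (2 * (th / 2)) by field. rewrite cos_2a_sin. nra.
Qed.

Lemma sin_sqr (th : R) : sin th * sin th = 1 - cos th * cos th.
Proof. generalize (sin2_cos2 th). unfold Rsqr. lra. Qed.

Lemma Derive_cosh (x : R) : Derive (fun y => cosh y) x = sinh x.
Proof. apply is_derive_unique, is_derive_cosh. Qed.

Lemma Derive_sinh (x : R) : Derive (fun y => sinh y) x = cosh x.
Proof. apply is_derive_unique, is_derive_sinh. Qed.

Ltac cr_derive :=
  auto_derive;
  [ repeat split; first [ now exists (sinh _); apply is_derive_cosh
                        | now eexists; apply is_derive_sinh
                        | now eexists; apply is_derive_cosh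
                        | lra | idtac ]
  | rewrite ?Derive_cosh, ?Derive_sinh ].

Lemma is_derive_half_coth_re_1 (p th : R) : coth_den p th <> 0 ->
  is_derive (fun p => half_coth_re p th) p (half_coth_re' p th).
Proof.
unfold half_coth_re, half_coth_re', coth_den. intros H. cr_derive.
replace (1 - cosh p * cos th) with (cosh p * (cosh p - cos th) - sinh p * sinh p)
  by (generalize (cosh_sqr p); lra).
field. lra.
Qed.

Lemma is_derive_half_coth_im_1 (p th : R) : coth_den p th <> 0 ->
  is_derive (fun p => half_coth_im p th) p (half_coth_im' p th).
Proof.
unfold half_coth_im, half_coth_im', coth_den. intros H. cr_derive.
field. lra.
Qed.

(** The four partial derivatives use only two expressions, which is the Cauchy-Riemann system for
    the half cotangent. *)
Lemma is_derive_half_coth_re_2 (p th : R) : coth_den p th <> 0 ->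
  is_derive (fun th => half_coth_re p th) th (- half_coth_im' p th).
Proof.
unfold half_coth_re, half_coth_im', coth_den. intros H. cr_derive.
field. lra.
Qed.

Lemma is_derive_half_coth_im_2 (p th : R) : coth_den p th <> 0 ->
  is_derive (fun th => half_coth_im p th) th (half_coth_re' p th).
Proof.
unfold half_coth_im, half_coth_re', coth_den. intros H. cr_derive.
replace (1 - cosh p * cos th) with (- (cos th * (cosh p - cos th) - sin th * sin th))
  by (generalize (sin_sqr th); lra).
field. lra.
Qed.

(* Real and imaginary parts of [h (u + i th)], [h v = (1 / 2 + coth ((v - a) / 2) / 2) / v]. *)
Definition kernel_re (a u th : R) : R :=
  (u * (/ 2 + half_coth_re (u - a) th) + th * half_coth_im (u - a) th) / (u ^ 2 + th ^ 2).
Definition kernel_im (a u th : R) : R :=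
  (u * half_coth_im (u - a) th - th * (/ 2 + half_coth_re (u - a) th)) / (u ^ 2 + th ^ 2).
Definition kernel_re' (a u th : R) : R :=
  (/ 2 + half_coth_re (u - a) th + u * half_coth_re' (u - a) th
     + th * half_coth_im' (u - a) th) / (u ^ 2 + th ^ 2)
  - 2 * u * (u * (/ 2 + half_coth_re (u - a) th) + th * half_coth_im (u - a) th)
     / (u ^ 2 + th ^ 2) ^ 2.

Lemma is_derive_kernel_re_u (a u th : R) : 0 < th < 2 * PI ->
  is_derive (fun u => kernel_re a u th) u (kernel_re' a u th).
Proof.
intros H. assert (HN := coth_den_pos (u - a) th H).
assert (D1 := is_derive_half_coth_re_1 (u - a) th ltac:(lra)).
assert (D2 := is_derive_half_coth_im_1 (u - a) th ltac:(lra)).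
assert (Hr : u ^ 2 + th ^ 2 <> 0) by nra.
unfold kernel_re, kernel_re'.
set (X := fun p => half_coth_re p th) in *. set (Y := fun p => half_coth_im p th) in *.
(* With [X] and [Y] opaque, [auto_derive] leaves their derivatives symbolic, to be filled in from
   [D1] and [D2]. *)
change (is_derive (fun u => (u * (/ 2 + X (u - a)) + th * Y (u - a)) / (u ^ 2 + th ^ 2)) u
 ((/ 2 + X (u - a) + u * half_coth_re' (u - a) th
     + th * half_coth_im' (u - a) th) / (u ^ 2 + th ^ 2)
  - 2 * u * (u * (/ 2 + X (u - a)) + th * Y (u - a))
     / (u ^ 2 + th ^ 2) ^ 2)).
auto_derive.
- repeat split; try lra; eexists; eassumption.
- change (u + - a) with (u - a).
  replace (Derive (fun x => X x) (u - a)) with (half_coth_re' (u - a) th)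
    by (symmetry; now apply is_derive_unique).
  replace (Derive (fun x => Y x) (u - a)) with (half_coth_im' (u - a) th)
    by (symmetry; now apply is_derive_unique).
  field. lra.
Qed.

(* The Cauchy-Riemann equation for [kernel_re + i kernel_im]. *)
Lemma is_derive_kernel_im_th (a u th : R) : 0 < th < 2 * PI ->
  is_derive (fun th => kernel_im a u th) th (kernel_re' a u th).
Proof.
intros H. assert (HN := coth_den_pos (u - a) th H).
assert (D1 := is_derive_half_coth_re_2 (u - a) th ltac:(lra)).
assert (D2 := is_derive_half_coth_im_2 (u - a) th ltac:(lra)).
assert (Hr : u ^ 2 + th ^ 2 <> 0) by nra.
unfold kernel_im, kernel_re'.
set (X := fun th => half_coth_re (u - a) th) in *. set (Y := fun th => half_coth_im (u - a) th) in *.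
change (is_derive (fun th => (u * Y th - th * (/ 2 + X th)) / (u ^ 2 + th ^ 2)) th
 ((/ 2 + X th + u * half_coth_re' (u - a) th
     + th * half_coth_im' (u - a) th) / (u ^ 2 + th ^ 2)
  - 2 * u * (u * (/ 2 + X th) + th * Y th)
     / (u ^ 2 + th ^ 2) ^ 2)).
auto_derive.
- repeat split; try lra; eexists; eassumption.
- replace (Derive (fun x => X x) th) with (- half_coth_im' (u - a) th)
    by (symmetry; now apply is_derive_unique).
  replace (Derive (fun x => Y x) th) with (half_coth_re' (u - a) th)
    by (symmetry; now apply is_derive_unique).
  field. lra.
Qed.

Lemma continuity_pt_of_is_derive (f : R -> R) (x l : R) : is_derive f x l -> continuity_pt f x.
Proof. intros H. apply derivable_continuous_pt. exists l. now apply is_derive_Reals. Qed.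

Lemma continuity_2d_kernel_re' (a u th : R) : 0 < th < 2 * PI ->
  continuity_2d_pt (fun th u => kernel_re' a u th) th u.
Proof.
intros H. assert (HN := coth_den_pos (u - a) th H).
assert (Hr : u ^ 2 + th ^ 2 <> 0) by nra.
unfold kernel_re', half_coth_re, half_coth_re', half_coth_im, half_coth_im', Rdiv, coth_den, cosh, sinh in *.
simpl. simpl in Hr.
repeat first [ apply continuity_2d_pt_plus | apply continuity_2d_pt_minus
  | apply continuity_2d_pt_mult | apply continuity_2d_pt_opp
  | apply continuity_2d_pt_const | apply continuity_2d_pt_id1 | apply continuity_2d_pt_id2
  | apply continuity_2d_pt_inv
  | apply (continuity_1d_2d_pt_comp exp); [apply derivable_continuous, derivable_exp |]
  | apply (continuity_1d_2d_pt_comp cos) | apply (continuity_1d_2d_pt_comp sin)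
  | apply continuity_cos | apply continuity_sin ];
repeat apply Rmult_integral_contrapositive_currified; simpl; lra.
Qed.

Lemma continuous_kernel_re' (a u th : R) : 0 < th < 2 * PI ->
  continuous (fun u => kernel_re' a u th) u.
Proof.
intros H. apply continuity_pt_filterlim. intros eps Heps.
destruct (continuity_2d_kernel_re' a u th H (mkposreal eps Heps)) as [d Hd].
exists d. split; [apply cond_pos|]. intros x [_ Hx].
unfold dist; simpl; unfold Rdist. apply Hd; [|exact Hx].
unfold Rminus. rewrite Rplus_opp_r, Rabs_R0. apply cond_pos.
Qed.

Lemma continuous_kernel_im (a u th : R) : 0 < th < 2 * PI ->
  continuous (fun u => kernel_im a u th) u.
Proof.
intros H. assert (HN := coth_den_pos (u - a) th H).
apply (ex_derive_continuous (fun u => kernel_im a u th)).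
assert (Hr : u ^ 2 + th ^ 2 <> 0) by nra.
unfold kernel_im, half_coth_re, half_coth_im, coth_den in *.
auto_derive. simpl in Hr. unfold Rminus in HN.
repeat split; try (eexists; first [apply is_derive_sinh|apply is_derive_cosh]); lra.
Qed.

(** This replaces Cauchy's theorem on a rectangle: after differentiation under the integral sign,
    the integrand is the [u]-derivative of [kernel_re], so only the two vertical sides remain. *)
Lemma is_derive_RInt_kernel_im (a r th : R) : 0 < th < 2 * PI ->
  is_derive (fun th => RInt (fun u => kernel_im a u th) (- r) r) th
    (kernel_re a r th - kernel_re a (- r) th).
Proof.
intros H.
assert (Hl : locally th (fun t => 0 < t < 2 * PI)).
{ apply (open_and (fun t => 0 < t) (fun t => t < 2 * PI)); auto using open_gt, open_lt. }
assert (E : RInt (fun u => Derive (fun t => kernel_im a u t) th) (- r) r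
   = kernel_re a r th - kernel_re a (- r) th).
{ rewrite (RInt_ext _ (fun u => kernel_re' a u th)).
  - apply is_RInt_unique.
    apply (is_RInt_derive (fun u => kernel_re a u th) (fun u => kernel_re' a u th)); intros u _.
    + now apply is_derive_kernel_re_u.
    + now apply continuous_kernel_re'.
  - intros u _. now apply is_derive_unique, is_derive_kernel_im_th. }
rewrite <- E.
apply (is_derive_RInt_param (fun th u => kernel_im a u th)).
- revert Hl. apply filter_imp. intros t Ht u _. eexists. now apply is_derive_kernel_im_th.
- intros u _. apply continuity_2d_pt_ext_loc with (fun t u => kernel_re' a u t).
  + destruct Hl as [d Hd]. exists d. intros t v Ht _. symmetry.
    apply is_derive_unique, is_derive_kernel_im_th, Hd, Ht.
  + now apply continuity_2d_kernel_re'.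
- revert Hl. apply filter_imp. intros t Ht.
  apply (ex_RInt_continuous (V := R_CompleteNormedModule)). intros u _.
  now apply continuous_kernel_im.
Qed.

(** The decay is that of [1 / v]. At distance at least 1 from [a] one has [cosh (u - a) >= 3 / 2],
    hence [cosh <= 3 * coth_den], and the half cotangent is bounded uniformly in [th]. *)
Lemma kernel_re_bound (a u th : R) : 0 < th < 2 * PI -> Rabs a + 1 <= Rabs u ->
  Rabs (kernel_re a u th) <= 3 / Rabs u.
Proof.
intros H Hu. assert (Ha := Rabs_pos a).
assert (Hp : 1 <= Rabs (u - a)) by (generalize (Rabs_triang_inv u a); lra).
set (p := u - a) in *.
assert (HN := coth_den_pos p th H).
assert (Hc : 3 / 2 <= cosh p).
{ generalize (cosh_ge_quadratic p). intros. assert (1 <= p ^ 2); [|lra].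
  rewrite <- (pow1 2), <- (pow2_abs p). apply pow_incr. lra. }
assert (Hs := cosh_sqr p).
assert (HNc : cosh p <= 3 * coth_den p th).
{ unfold coth_den. generalize (COS_bound th). lra. }
assert (HX : Rabs (half_coth_re p th) <= 3 / 2).
{ unfold half_coth_re, Rdiv. rewrite Rabs_mult, (Rabs_right (/ _)) by
    (apply Rle_ge, Rlt_le, Rinv_0_lt_compat; lra).
  apply Rmult_le_reg_r with (2 * coth_den p th); [lra|].
  rewrite Rmult_assoc, Rinv_l, Rmult_1_r by lra.
  apply Rabs_le. split; nra. }
assert (HY : Rabs (half_coth_im p th) <= 1).
{ unfold half_coth_im, Rdiv. rewrite Rabs_mult, (Rabs_right (/ _)) by
    (apply Rle_ge, Rlt_le, Rinv_0_lt_compat; lra).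
  apply Rmult_le_reg_r with (2 * coth_den p th); [lra|].
  rewrite Rmult_assoc, Rinv_l, Rmult_1_r by lra.
  rewrite Rabs_Ropp. generalize (SIN_bound th). intros. apply Rabs_le. lra. }
unfold kernel_re. fold p.
set (X := half_coth_re p th) in *. set (Y := half_coth_im p th) in *.
assert (Hr : 0 < u ^ 2 + th ^ 2) by nra.
unfold Rdiv. rewrite Rabs_mult, (Rabs_right (/ (u ^ 2 + th ^ 2))) by
  (apply Rle_ge, Rlt_le, Rinv_0_lt_compat; lra).
apply Rmult_le_reg_r with (u ^ 2 + th ^ 2); [lra|].
rewrite Rmult_assoc, Rinv_l, Rmult_1_r by lra.
apply Rmult_le_reg_r with (Rabs u); [lra|].
replace (3 * / Rabs u * (u ^ 2 + th ^ 2) * Rabs u) with (3 * (Rabs u ^ 2 + th ^ 2))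
  by (rewrite pow2_abs; field; lra).
assert (T : Rabs (u * (/ 2 + X) + th * Y) <= Rabs u * 2 + th).
{ eapply Rle_trans; [apply Rabs_triang|]. rewrite !Rabs_mult, (Rabs_right th) by lra.
  apply Rplus_le_compat.
  - apply Rmult_le_compat_l; [lra|]. eapply Rle_trans; [apply Rabs_triang|].
    rewrite (Rabs_right (/ 2)) by lra. lra.
  - rewrite <- (Rmult_1_r th) at 2. apply Rmult_le_compat_l; lra. }
apply Rle_trans with ((Rabs u * 2 + th) * Rabs u); [apply Rmult_le_compat_r; lra|].
nra.
Qed.

(** Mean value theorem in the height: each vertical side contributes at most [3 / r] to the
    derivative, over a height of at most [PI]. The bound does not depend on [th], so it survives
    [th -> 0]. *)
Lemma RInt_kernel_im_shift (a r th : R) : 0 < th <= PI -> Rabs a + 1 <= r ->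
  Rabs (RInt (fun u => kernel_im a u PI) (- r) r - RInt (fun u => kernel_im a u th) (- r) r)
    <= 6 * PI / r.
Proof.
intros Hth Hr. assert (HP := PI_RGT_0). assert (Ha := Rabs_pos a).
destruct (MVT_gen (fun th => RInt (fun u => kernel_im a u th) (- r) r) th PI
  (fun th => kernel_re a r th - kernel_re a (- r) th)) as [t [Ht E]].
- intros t Ht. apply is_derive_RInt_kernel_im. rewrite Rmin_left, Rmax_right in Ht by lra. lra.
- intros t Ht. eapply continuity_pt_of_is_derive, is_derive_RInt_kernel_im.
  rewrite Rmin_left, Rmax_right in Ht by lra. lra.
- rewrite Rmin_left, Rmax_right in Ht by lra. rewrite E, Rabs_mult.
  assert (Er : Rabs r = r) by (apply Rabs_right; lra).
  assert (B1 := kernel_re_bound a r t ltac:(lra) ltac:(lra)).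
  assert (B2 := kernel_re_bound a (- r) t ltac:(lra) ltac:(rewrite Rabs_Ropp; lra)).
  rewrite Er in B1. rewrite (Rabs_Ropp r), Er in B2.
  replace (6 * PI / r) with ((3 / r + 3 / r) * PI) by (field; lra).
  apply Rmult_le_compat; try apply Rabs_pos.
  + unfold Rminus. eapply Rle_trans; [apply Rabs_triang|]. rewrite Rabs_Ropp. lra.
  + rewrite Rabs_right; lra.
Qed.

Lemma kernel_im_PI (a u : R) :
  kernel_im a u PI = - PI * (cauchy_density u / (1 + exp (a - u))).
Proof.
unfold kernel_im, half_coth_re, half_coth_im, coth_den, cauchy_density.
rewrite sin_PI, cos_PI. replace (a - u) with (- (u - a)) by ring. set (p := u - a).
unfold sinh, cosh. rewrite exp_Ropp. generalize (exp_pos p), (cauchy_denominator_pos u), PI_RGT_0. intros.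
field. repeat split; try nra.
Qed.

(** * Behaviour near the real axis *)

Lemma coth_den_taylor (L p th : R) : Rabs p <= L -> 0 < th <= 1 ->
  (p ^ 2 + th ^ 2) / 2 <= 2 * coth_den p th /\
  Rabs (2 * coth_den p th - (p ^ 2 + th ^ 2)) <= 2 * exp L * (p ^ 2 + th ^ 2) ^ 2.
Proof.
intros Hp Hth. destruct (sinh_cosh_taylor L p Hp) as [_ Hc].
generalize (cosh_ge_quadratic p), (cos_ge_quadratic th ltac:(lra)), (cos_le_quartic th ltac:(lra)).
intros H1 H2 H3. unfold coth_den.
assert (HE : 1 <= exp L).
{ generalize (exp_ineq1_le L), (Rabs_pos p). lra. }
assert (Ht : 0 <= th ^ 2 <= 1) by (split; [nra|]; rewrite <- (pow1 2); apply pow_incr; lra).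
assert (Hp2 : 0 <= p ^ 2) by apply pow2_ge_0.
replace (p ^ 4) with (p ^ 2 * p ^ 2) in * by ring.
replace (th ^ 4) with (th ^ 2 * th ^ 2) in * by ring.
set (P := p ^ 2) in *. set (T := th ^ 2) in *. set (E := exp L) in *.
assert (0 <= P * P) by nra. assert (0 <= T * T) by nra. assert (0 <= P * T) by nra.
assert (0 <= E * (P * P)) by (apply Rmult_le_pos; lra).
assert (T * T <= E * (T * T)) by nra.
assert (0 <= E * (P * T)) by (apply Rmult_le_pos; lra).
replace (2 * E * (P + T) ^ 2) with (2 * (E * (P * P)) + 4 * (E * (P * T)) + 2 * (E * (T * T))) by ring.
split; [nra|]. apply Rabs_le. split; lra.
Qed.

(** Meant for [q = p ^ 2 + th ^ 2] and [d = 2 * coth_den p th]: removing the pole leaves a numerator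
    of order [q ^ 2], which cancels the denominator. *)
Lemma Rabs_quotient_le (n d q c : R) :
  0 < q -> q / 2 <= d -> Rabs n <= c * q ^ 2 -> Rabs (n / (q * d)) <= 2 * c.
Proof.
intros Hq Hd Hn. assert (0 < q * d) by (apply Rmult_lt_0_compat; lra).
assert (0 <= c).
{ apply Rmult_le_reg_r with (q ^ 2); [apply pow_lt; lra|]. generalize (Rabs_pos n). lra. }
unfold Rdiv. rewrite Rabs_mult, (Rabs_right (/ _)) by
  (apply Rle_ge, Rlt_le, Rinv_0_lt_compat; lra).
apply Rmult_le_reg_r with (q * d); [lra|].
rewrite Rmult_assoc, Rinv_l, Rmult_1_r by lra.
assert (q * (q / 2) <= q * d) by (apply Rmult_le_compat_l; lra). nra.
Qed.

(* The pole [1 / (p + i th)] of the half cotangent, subtracted. *)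
Definition regular_re (p th : R) : R := half_coth_re p th - p / (p ^ 2 + th ^ 2).
Definition regular_im (p th : R) : R := half_coth_im p th + th / (p ^ 2 + th ^ 2).

(** The factor [th] is essential, since [regular_im] is later multiplied by [u / (u ^ 2 + th ^ 2)].
    It comes from oddness in [th]: both terms of the numerator carry it. *)
Lemma regular_im_bound (L p th : R) : Rabs p <= L -> 0 < th <= 1 ->
  Rabs (regular_im p th) <= 6 * exp L * th.
Proof.
intros Hp Hth. destruct (coth_den_taylor L p th Hp Hth) as [H1 H2].
assert (Hq : 0 < p ^ 2 + th ^ 2) by nra.
unfold regular_im, half_coth_im.
set (d := 2 * coth_den p th) in *. set (q := p ^ 2 + th ^ 2) in *.
replace (- sin th / d + th / q) with ((th * (d - q) + q * (th - sin th)) / (q * d)) by (field; lra).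
replace (6 * exp L * th) with (2 * (3 * exp L * th)) by ring.
apply Rabs_quotient_le; [lra|lra|].
assert (HE : 1 <= exp L) by (generalize (exp_ineq1_le L), (Rabs_pos p); lra).
assert (S : 0 <= th - sin th <= th * q).
{ generalize (sin_le_id th ltac:(lra)), (sin_ge_cubic th ltac:(lra)). intros.
  assert (th * th ^ 2 <= th * q) by (apply Rmult_le_compat_l; unfold q; nra).
  assert (0 <= th ^ 3) by (apply pow_le; lra).
  replace (th * th ^ 2) with (th ^ 3) in * by ring. lra. }
eapply Rle_trans; [apply Rabs_triang|]. rewrite !Rabs_mult.
rewrite (Rabs_right th), (Rabs_right q), (Rabs_right (th - sin th)) by lra.
assert (th * Rabs (d - q) <= th * (2 * exp L * q ^ 2)) by (apply Rmult_le_compat_l; lra).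
assert (q * (th - sin th) <= q * (th * q)) by (apply Rmult_le_compat_l; lra).
assert (0 <= th * q ^ 2) by (apply Rmult_le_pos; [lra|apply pow2_ge_0]).
assert (th * q ^ 2 <= exp L * (th * q ^ 2)) by nra.
replace (q * (th * q)) with (th * q ^ 2) in * by ring. nra.
Qed.

Lemma regular_re_bound (L p th : R) : Rabs p <= L -> 0 < th <= 1 ->
  Rabs (regular_re p th) <= 6 * exp L * L.
Proof.
intros Hp Hth. destruct (coth_den_taylor L p th Hp Hth) as [H1 H2].
destruct (sinh_cosh_taylor L p Hp) as [Hs _].
assert (Hq : 0 < p ^ 2 + th ^ 2) by nra.
assert (Hpq : p ^ 2 <= p ^ 2 + th ^ 2) by nra.
unfold regular_re, half_coth_re.
set (d := 2 * coth_den p th) in *. set (q := p ^ 2 + th ^ 2) in *.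
replace (sinh p / d - p / q) with ((q * (sinh p - p) + - p * (d - q)) / (q * d)) by (field; lra).
replace (6 * exp L * L) with (2 * (3 * exp L * L)) by ring.
apply Rabs_quotient_le; [lra|lra|].
assert (HE := exp_pos L). assert (Hp0 := Rabs_pos p).
eapply Rle_trans; [apply Rabs_triang|]. rewrite !Rabs_mult, Rabs_Ropp, (Rabs_right q) by lra.
assert (A1 : q * Rabs (sinh p - p) <= q * (exp L * q * L)).
{ apply Rmult_le_compat_l; [lra|]. eapply Rle_trans; [exact Hs|].
  apply Rmult_le_compat; try lra.
  - apply Rmult_le_pos; [lra|apply pow2_ge_0].
  - apply Rmult_le_compat_l; lra. }
assert (A2 : Rabs p * Rabs (d - q) <= L * (2 * exp L * q ^ 2)).
{ apply Rmult_le_compat; try lra. apply Rabs_pos. }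
replace (3 * exp L * L * q ^ 2) with (q * (exp L * q * L) + L * (2 * exp L * q ^ 2)) by ring.
lra.
Qed.

(** The limit of [regular_re p th] on the real axis for nonzero [p], namely
    [coth (p / 2) / 2 - 1 / p]. *)
Definition regular_real (p : R) : R := sinh p / (2 * (cosh p - 1)) - / p.

Lemma regular_re_vs_real (a L p th : R) : a <> 0 -> Rabs p <= L -> Rabs a / 2 <= Rabs p -> 0 < th <= 1 ->
  Rabs (regular_re p th - regular_real p) <= (32 * exp L / Rabs a ^ 4 + 8 / Rabs a ^ 3) * th.
Proof.
intros Ha HL Hp Hth. apply Rabs_pos_lt in Ha. set (A := Rabs a) in *.
(* From [Rabs p >= A / 2], both [cosh p - 1] and [coth_den p th] are at least [A ^ 2 / 8], whence
   the 32; and [Rabs p * (p ^ 2 + th ^ 2)] is at least [A ^ 3 / 8], whence the 8. *)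
assert (Hp0 : p <> 0) by (intros ->; rewrite Rabs_R0 in Hp; lra).
assert (Hp2 : A ^ 2 / 4 <= p ^ 2).
{ rewrite <- (pow2_abs p). replace (A ^ 2 / 4) with ((A / 2) ^ 2) by field. apply pow_incr. lra. }
assert (HA2 : 0 < A ^ 2) by (apply pow_lt; lra).
assert (H0 : A ^ 2 / 8 <= cosh p - 1) by (generalize (cosh_ge_quadratic p); lra).
assert (Hc1 : 0 <= 1 - cos th <= th).
{ generalize (COS_bound th), (cos_ge_quadratic th ltac:(lra)). intros. nra. }
assert (H1 : A ^ 2 / 8 <= coth_den p th) by (unfold coth_den; lra).
assert (Hs : Rabs (sinh p) <= exp L).
{ generalize (cosh_le_exp L p HL), (cosh_sqr p), (cosh_ge_1 p). intros. apply Rabs_le. split; nra. }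
assert (Hq : 0 < p ^ 2 + th ^ 2) by nra.
assert (Hden : cosh p - cos th = coth_den p th) by reflexivity.
unfold regular_re, regular_real, half_coth_re.
replace (sinh p / (2 * coth_den p th) - p / (p ^ 2 + th ^ 2) - (sinh p / (2 * (cosh p - 1)) - / p))
  with (sinh p * (cos th - 1) * / (2 * (coth_den p th * (cosh p - 1))) + th ^ 2 * / (p * (p ^ 2 + th ^ 2))).
2:{ replace (cos th) with (cosh p - coth_den p th) by lra. field. repeat split; lra. }
eapply Rle_trans; [apply Rabs_triang|]. rewrite Rmult_plus_distr_r. apply Rplus_le_compat.
- rewrite !Rabs_mult, Rabs_inv.
  assert (M : (A ^ 2 / 8) * (A ^ 2 / 8) <= coth_den p th * (cosh p - 1)) by (apply Rmult_le_compat; lra).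
  assert (0 < (A ^ 2 / 8) * (A ^ 2 / 8)) by (apply Rmult_lt_0_compat; lra).
  rewrite (Rabs_right (2 * _)) by lra.
  replace (32 * exp L / A ^ 4 * th) with (exp L * th * / (2 * ((A ^ 2 / 8) * (A ^ 2 / 8)))) by (field; lra).
  assert (Rabs (cos th - 1) <= th) by (apply Rabs_le; lra).
  apply Rmult_le_compat.
  + apply Rmult_le_pos; apply Rabs_pos.
  + apply Rlt_le, Rinv_0_lt_compat; lra.
  + apply Rmult_le_compat; auto using Rabs_pos.
  + apply Rinv_le_contravar; lra.
- rewrite !Rabs_mult, Rabs_inv, Rabs_mult.
  rewrite (Rabs_right (p ^ 2 + th ^ 2)), (Rabs_right (th ^ 2)) by nra.
  assert (M : A / 2 * (A ^ 2 / 4) <= Rabs p * (p ^ 2 + th ^ 2)).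
  { apply Rmult_le_compat; nra. }
  assert (0 < A / 2 * (A ^ 2 / 4)) by (apply Rmult_lt_0_compat; lra).
  replace (8 / A ^ 3 * th) with (th * / (A / 2 * (A ^ 2 / 4))) by (field; lra).
  apply Rmult_le_compat.
  + nra.
  + apply Rlt_le, Rinv_0_lt_compat; lra.
  + nra.
  + apply Rinv_le_contravar; lra.
Qed.

Lemma is_derive_locally_lipschitz (f : R -> R) (x l : R) : is_derive f x l ->
  exists d : posreal, forall h, Rabs h < d -> Rabs (f (x + h) - f x) <= (Rabs l + 1) * Rabs h.
Proof.
intros H. apply is_derive_Reals in H. destruct (H 1 Rlt_0_1) as [d Hd].
exists d. intros h Hh. destruct (Req_dec h 0) as [->|H0].
- rewrite Rplus_0_r. unfold Rminus. rewrite Rplus_opp_r, Rabs_R0. lra.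
- specialize (Hd h H0 Hh).
  replace (f (x + h) - f x) with (((f (x + h) - f x) / h - l + l) * h) by (field; auto).
  rewrite Rabs_mult. apply Rmult_le_compat_r; [apply Rabs_pos|].
  eapply Rle_trans; [apply Rabs_triang|]. lra.
Qed.

Lemma ex_derive_regular_real (p : R) : p <> 0 -> ex_derive regular_real p.
Proof.
intros Hp. unfold regular_real. auto_derive.
assert (0 < p ^ 2) by (generalize (pow2_ge_0 p), (pow_nonzero p 2 Hp); lra).
generalize (cosh_ge_quadratic p). intros.
repeat split; try (eexists; first [apply is_derive_sinh|apply is_derive_cosh]); lra.
Qed.

(** Near [u = 0] the point [u - a] stays away from 0, and the limit function is differentiable at
    [- a]. Elsewhere [Rabs u] is bounded below, so mere boundedness of [regular_re] suffices. *)
Lemma regular_re_lipschitz (a r : R) : a <> 0 -> 0 < r ->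
  exists M, 0 <= M /\ forall u th, Rabs u <= r -> 0 < th <= 1 ->
    Rabs (regular_re (u - a) th - regular_real (- a)) <= M * (Rabs u + th).
Proof.
intros Ha Hr. assert (HA := Rabs_pos_lt a Ha).
destruct (ex_derive_regular_real (- a) ltac:(lra)) as [l Hl].
destruct (is_derive_locally_lipschitz _ _ _ Hl) as [d Hd].
set (L := r + Rabs a). set (d' := Rmin d (Rabs a / 2)).
assert (Hd' : 0 < d') by (apply Rmin_pos; [apply cond_pos|lra]).
assert (HE := exp_pos L).
set (M1 := 32 * exp L / Rabs a ^ 4 + 8 / Rabs a ^ 3).
set (M2 := (6 * exp L * L + Rabs (regular_real (- a))) / d').
assert (HM1 : 0 <= M1).
{ apply Rplus_le_le_0_compat; apply Rdiv_le_0_compat; try lra; apply pow_lt; lra. }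
assert (HL : 0 < L) by (unfold L; lra).
assert (HM2 : 0 <= M2).
{ apply Rdiv_le_0_compat; [|lra]. apply Rplus_le_le_0_compat; [|apply Rabs_pos].
  apply Rmult_le_pos; lra. }
assert (Hl0 := Rabs_pos l).
exists (M1 + M2 + (Rabs l + 1)). split; [lra|].
intros u th Hu Hth. assert (Hu0 := Rabs_pos u).
assert (Hp : Rabs (u - a) <= L).
{ unfold Rminus. eapply Rle_trans; [apply Rabs_triang|]. rewrite Rabs_Ropp. unfold L. lra. }
destruct (Rlt_or_le (Rabs u) d') as [H|H].
- assert (Rabs u < d /\ Rabs u < Rabs a / 2) as [H1 H2].
  { generalize (Rmin_l d (Rabs a / 2)), (Rmin_r d (Rabs a / 2)). unfold d' in H. lra. }
  specialize (Hd u H1). replace (- a + u) with (u - a) in Hd by ring.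
  assert (Hp' : Rabs a / 2 <= Rabs (u - a)).
  { generalize (Rabs_triang_inv a u). rewrite (Rabs_minus_sym a u). lra. }
  generalize (regular_re_vs_real a L (u - a) th Ha Hp Hp' Hth). fold M1. intros B.
  replace (regular_re (u - a) th - regular_real (- a)) with
    ((regular_re (u - a) th - regular_real (u - a)) + (regular_real (u - a) - regular_real (- a))) by ring.
  eapply Rle_trans; [apply Rabs_triang|].
  apply Rle_trans with (M1 * th + (Rabs l + 1) * Rabs u); [lra|].
  assert (0 <= M1 * Rabs u) by (apply Rmult_le_pos; lra).
  assert (0 <= M2 * (Rabs u + th)) by (apply Rmult_le_pos; lra).
  assert (0 <= (Rabs l + 1) * th) by (apply Rmult_le_pos; lra). lra.
- generalize (regular_re_bound L (u - a) th Hp Hth). intros B.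
  apply Rle_trans with (M2 * Rabs u).
  + apply Rle_trans with (M2 * d').
    * unfold M2, Rminus. replace (_ / d' * d') with (6 * exp L * L + Rabs (regular_real (- a))) by (field; lra).
      eapply Rle_trans; [apply Rabs_triang|]. rewrite Rabs_Ropp. fold (u - a). lra.
    * apply Rmult_le_compat_l; lra.
  + assert (0 <= M1 * (Rabs u + th)) by (apply Rmult_le_pos; lra).
    assert (0 <= (Rabs l + 1) * (Rabs u + th)) by (apply Rmult_le_pos; lra).
    assert (0 <= M2 * th) by (apply Rmult_le_pos; lra). lra.
Qed.

(** The value [1 / 2 + coth (- a / 2) / 2] is [1 / (1 - exp a)], and the subtracted pole at [- a]
    supplies [1 / a]. *)
Lemma regular_real_residue (a : R) : a <> 0 ->
  / 2 + regular_real (- a) = / a + / (1 - exp a).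
Proof.
intros Ha. unfold regular_real, sinh, cosh. rewrite Ropp_involutive, exp_Ropp.
assert (He := exp_pos a).
assert (exp a <> 1). { intros H. apply Ha. apply exp_inv. now rewrite exp_0. }
field. repeat split; try lra.
assert (D : (exp a - 1) * (exp a - 1) <> 0)
  by (apply Rmult_integral_contrapositive_currified; lra).
lra.
Qed.

(* Residues of the kernel: [/ (1 - exp a)] at [0] and [/ a] at [a]. *)
Lemma kernel_im_near_axis (a r : R) : a <> 0 -> 0 < r ->
  exists M, 0 <= M /\ forall u d, Rabs u <= r -> 0 < d <= 1 ->
    Rabs (kernel_im a u (d ^ 2) + / (1 - exp a) * (d ^ 2 / (u ^ 2 + (d ^ 2) ^ 2))
       + / a * (d ^ 2 / ((u - a) ^ 2 + (d ^ 2) ^ 2)))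
    <= M * (d * (d ^ 2 / (u ^ 2 + (d ^ 2) ^ 2)) + d).
Proof.
intros Ha Hr. destruct (regular_re_lipschitz a r Ha Hr) as [M1 [HM1 B]].
set (L := r + Rabs a). set (M2 := 6 * exp L).
assert (HM2 : 0 < M2) by (apply Rmult_lt_0_compat; [lra|apply exp_pos]).
exists (2 * (M1 + M2)). split; [lra|]. intros u d Hu Hd.
(* Parametrizing the height by its square root [d] makes the error linear in [d]: the cross term
   [Rabs u * th] splits into a part absorbed by the Poisson kernel and a part bounded after
   division. *)
set (th := d ^ 2). assert (Hth : 0 < th <= 1).
{ split; [apply pow_lt; lra|]. unfold th. rewrite <- (pow1 2). apply pow_incr. lra. }
assert (Hp : Rabs (u - a) <= L).
{ unfold Rminus. eapply Rle_trans; [apply Rabs_triang|]. rewrite Rabs_Ropp. unfold L. lra. }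
specialize (B u th Hu Hth). assert (B2 := regular_im_bound L (u - a) th Hp Hth). fold M2 in B2.
assert (Hq : forall v, 0 < v ^ 2 + th ^ 2).
{ intros v. generalize (pow2_ge_0 v), (pow_lt th 2 ltac:(lra)). lra. }
assert (Hq1 := Hq u). assert (Hq2 := Hq (u - a)).
assert (E := regular_real_residue a Ha).
(* By partial fractions, [1 / (v (v - a))] is [1 / a] times [1 / (v - a) - 1 / v]. The total
   coefficient of [1 / v] is then [1 / 2 + regular_real (- a) - 1 / a], the residue at 0. *)
replace (kernel_im a u th + / (1 - exp a) * (th / (u ^ 2 + th ^ 2))
       + / a * (th / ((u - a) ^ 2 + th ^ 2)))
  with ((u * regular_im (u - a) th - th * (regular_re (u - a) th - regular_real (- a))) * / (u ^ 2 + th ^ 2)).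
2:{ replace (/ (1 - exp a)) with (/ 2 + regular_real (- a) - / a) by lra.
    unfold kernel_im, regular_re, regular_im.
    set (X := half_coth_re (u - a) th). set (Y := half_coth_im (u - a) th).
    set (Z := regular_real (- a)). field. lra. }
rewrite Rabs_mult, (Rabs_right (/ _)) by (apply Rle_ge, Rlt_le, Rinv_0_lt_compat; lra).
apply Rmult_le_reg_r with (u ^ 2 + th ^ 2); [lra|].
rewrite Rmult_assoc, Rinv_l, Rmult_1_r by lra.
replace (2 * (M1 + M2) * (d * (th / (u ^ 2 + th ^ 2)) + d) * (u ^ 2 + th ^ 2))
  with (2 * (M1 + M2) * (d * th + d * (u ^ 2 + th ^ 2))) by (field; lra).
assert (Hu0 := Rabs_pos u).
assert (T : Rabs (u * regular_im (u - a) th - th * (regular_re (u - a) th - regular_real (- a)))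
  <= Rabs u * (M2 * th) + th * (M1 * (Rabs u + th))).
{ unfold Rminus at 1. eapply Rle_trans; [apply Rabs_triang|].
  rewrite Rabs_Ropp, !Rabs_mult, (Rabs_right th) by lra.
  apply Rplus_le_compat; apply Rmult_le_compat_l; lra. }
eapply Rle_trans; [exact T|].
(* AM-GM with weight [d], recalling [th = d ^ 2]. *)
assert (G : Rabs u * th <= d * th + d * u ^ 2).
{ rewrite <- (pow2_abs u). unfold th.
  replace (Rabs u * d ^ 2) with (d * (Rabs u * d)) by ring.
  replace (d * d ^ 2 + d * Rabs u ^ 2) with (d * (d ^ 2 + Rabs u ^ 2)) by ring.
  apply Rmult_le_compat_l; [lra|]. generalize (pow2_ge_0 (d - Rabs u)), (pow2_ge_0 d), (pow2_ge_0 (Rabs u)). nra. }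
assert (G2 : th * th <= d * th).
{ apply Rmult_le_compat_r; [lra|]. unfold th. nra. }
assert (0 <= d * th) by nra. assert (0 <= d * u ^ 2) by (apply Rmult_le_pos; [lra|apply pow2_ge_0]).
assert (0 <= d * th ^ 2) by (apply Rmult_le_pos; [lra|apply pow2_ge_0]).
set (S := d * th + d * (u ^ 2 + th ^ 2)).
assert (S1 : Rabs u * th <= S) by (unfold S; lra).
assert (S2 : th * th <= S) by (unfold S; lra).
assert (0 <= S) by (unfold S; lra).
assert (M2 * (Rabs u * th) <= M2 * S) by (apply Rmult_le_compat_l; lra).
assert (M1 * (Rabs u * th) <= M1 * S) by (apply Rmult_le_compat_l; lra).
assert (M1 * (th * th) <= M1 * S) by (apply Rmult_le_compat_l; lra).
assert (0 <= M2 * S) by (apply Rmult_le_pos; lra).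
lra.
Qed.

(** * Limit at the real axis and value of the logistic integral *)

Lemma is_RInt_poisson_centered (a c x y : R) : 0 < c ->
  is_RInt (fun u => c / ((u - a) ^ 2 + c ^ 2)) x y (atan ((y - a) / c) - atan ((x - a) / c)).
Proof.
intros Hc.
apply is_RInt_ext with (fun u => scal 1 (c / ((1 * u + - a) ^ 2 + c ^ 2))).
- intros u _. unfold scal; simpl; unfold mult; simpl. unfold Rdiv. rewrite !Rmult_1_l. reflexivity.
- apply (is_RInt_comp_lin (fun u => c / (u ^ 2 + c ^ 2)) 1 (- a)).
  replace (1 * x + - a) with (x - a) by ring. replace (1 * y + - a) with (y - a) by ring.
  now apply is_RInt_poisson.
Qed.

(** By [atan (x / c) = PI / 2 - atan (c / x)] and [atan y <= y]. Used at both ends, it shows that a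
    Poisson kernel of scale [c] has mass [PI] up to [2 * c]. *)
Lemma atan_quotient_bound (x c : R) : 1 <= x -> 0 < c -> PI / 2 - c <= atan (x / c) <= PI / 2.
Proof.
intros Hx Hc. assert (Hy : 0 < c / x) by (apply Rdiv_lt_0_compat; lra).
split; [|generalize (atan_bound (x / c)); lra].
replace (x / c) with (/ (c / x)) by (field; lra). rewrite atan_inv by exact Hy.
assert (A : atan (c / x) <= c / x).
{ apply (le_of_derive_le atan (fun y => y) (fun y => / (1 + y ^ 2)) (fun _ => 1)); [lra|rewrite atan_0; lra| | |].
  - intros y. apply is_derive_Reals, derivable_pt_lim_atan.
  - intros y. auto_derive; auto.
  - intros y _. rewrite <- Rinv_1. apply Rinv_le_contravar; [lra|]. generalize (pow2_ge_0 y). lra. }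
assert (c / x <= c); [|lra].
apply Rmult_le_reg_r with x; [lra|]. unfold Rdiv. rewrite Rmult_assoc, Rinv_l, Rmult_1_r by lra. nra.
Qed.

Lemma RInt_kernel_im_near_axis (a r : R) : a <> 0 -> Rabs a + 1 <= r ->
  exists M, forall d, 0 < d <= 1 ->
    Rabs (RInt (fun u => kernel_im a u (d ^ 2)) (- r) r + PI * (/ a + / (1 - exp a))) <= M * d.
Proof.
intros Ha Hr. assert (Ha0 := Rabs_pos_lt a Ha). assert (HP := PI_RGT_0).
destruct (kernel_im_near_axis a r Ha ltac:(lra)) as [M [HM B]].
(* The first term is the integrated pointwise error; the other two pay for truncating the Poisson
   kernels at 0 and [a], both at distance at least 1 from the endpoints. *)
exists (M * (PI + 2 * r) + 2 * Rabs (/ (1 - exp a)) + 2 * Rabs (/ a)).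
intros d Hd. assert (Hth : 0 < d ^ 2 <= d) by (split; [apply pow_lt; lra|nra]).
assert (H1 : PI >= 1) by (generalize PI2_1; lra).
set (r0 := / (1 - exp a)) in *. set (r1 := / a) in *.
set (P0 := atan (r / d ^ 2) - atan (- r / d ^ 2)).
set (P1 := atan ((r - a) / d ^ 2) - atan ((- r - a) / d ^ 2)).
set (Q := RInt (fun u => kernel_im a u (d ^ 2)) (- r) r).
assert (E0 := is_RInt_poisson (d ^ 2) (- r) r ltac:(lra)).
assert (E1 := is_RInt_poisson_centered a (d ^ 2) (- r) r ltac:(lra)).
assert (EQ : is_RInt (fun u => kernel_im a u (d ^ 2)) (- r) r Q).
{ apply (RInt_correct (V := R_CompleteNormedModule)), (ex_RInt_continuous (V := R_CompleteNormedModule)).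
  intros u _. apply continuous_kernel_im. lra. }
assert (E := is_RInt_plus _ _ _ _ _ _ (is_RInt_plus _ _ _ _ _ _ EQ (is_RInt_scal _ _ _ r0 _ E0))
  (is_RInt_scal _ _ _ r1 _ E1)).
assert (EM := is_RInt_scal _ _ _ M _ (is_RInt_plus _ _ _ _ _ _ (is_RInt_scal _ _ _ d _ E0) (is_RInt_const (- r) r d))).
assert (T : Rabs (Q + r0 * P0 + r1 * P1) <= M * (d * P0 + (r - - r) * d)).
{ refine (norm_RInt_le _ _ (- r) r _ _ _ _ E EM); [lra|].
  intros u Hu. apply B; [apply Rabs_le; lra|lra]. }
assert (X0 : Rabs (PI - P0) <= 2 * d).
{ unfold P0. replace (- r / d ^ 2) with (- (r / d ^ 2)) by (field; lra). rewrite atan_opp.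
  generalize (atan_quotient_bound r (d ^ 2) ltac:(lra) ltac:(lra)). intros. apply Rabs_le. lra. }
assert (X1 : Rabs (PI - P1) <= 2 * d).
{ unfold P1. replace ((- r - a) / d ^ 2) with (- ((r + a) / d ^ 2)) by (field; lra). rewrite atan_opp.
  assert (Ha1 : Rabs a <= r - 1) by lra. apply Rabs_le_between in Ha1.
  generalize (atan_quotient_bound (r - a) (d ^ 2) ltac:(lra) ltac:(lra)).
  generalize (atan_quotient_bound (r + a) (d ^ 2) ltac:(lra) ltac:(lra)). intros. apply Rabs_le. lra. }
assert (X2 : P0 <= PI).
{ unfold P0. generalize (atan_bound (r / d ^ 2)), (atan_bound (- r / d ^ 2)). lra. }
replace (Q + PI * (r1 + r0)) with
  ((Q + r0 * P0 + r1 * P1) + (r0 * (PI - P0) + r1 * (PI - P1))) by ring.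
eapply Rle_trans; [apply Rabs_triang|].
assert (Y : Rabs (r0 * (PI - P0) + r1 * (PI - P1)) <= Rabs r0 * (2 * d) + Rabs r1 * (2 * d)).
{ eapply Rle_trans; [apply Rabs_triang|]. rewrite !Rabs_mult.
  apply Rplus_le_compat; apply Rmult_le_compat_l; auto using Rabs_pos. }
assert (M * (d * P0 + (r - - r) * d) <= M * (d * PI + (r - - r) * d)).
{ apply Rmult_le_compat_l; [lra|]. apply Rplus_le_compat_r, Rmult_le_compat_l; lra. }
lra.
Qed.

Lemma RInt_logistic_estimate (a r : R) : a <> 0 -> Rabs a + 1 <= r ->
  Rabs (RInt (fun u => cauchy_density u / (1 + exp (a - u))) (- r) r - (/ a + / (1 - exp a))) <= 6 / r.
Proof.
intros Ha Hr. assert (Ha0 := Rabs_pos a). assert (HP := PI_RGT_0).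
assert (H1 : PI >= 1) by (generalize PI2_1; lra).
set (J := RInt _ (- r) r). set (s := / a + / (1 - exp a)).
assert (EJ : RInt (fun u => kernel_im a u PI) (- r) r = - PI * J).
{ rewrite (RInt_ext _ (fun u => scal (- PI) (cauchy_density u / (1 + exp (a - u)))))
    by (intros; apply kernel_im_PI).
  apply (RInt_scal (V := R_CompleteNormedModule)).
  apply continuous_ex_RInt. intros u. apply (continuous_mult cauchy_density).
  - apply continuous_cauchy_density.
  - apply (ex_derive_continuous (fun u => / (1 + exp (a - u)))). auto_derive.
    generalize (exp_pos (a + - u)). lra. }
destruct (RInt_kernel_im_near_axis a r Ha Hr) as [M B]. fold s in B.
assert (L : Rabs (- PI * J + PI * s) <= 6 * PI / r).
(* [M] depends on [r] but not on [d], so letting [d] tend to 0 leaves only the cost of the shift. *)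
{ apply le_epsilon. intros eps Heps.
  set (d := Rmin 1 (eps / (Rabs M + 1))).
  assert (HM := Rabs_pos M).
  assert (Hd : 0 < d <= 1).
  { split; [apply Rmin_pos; [lra|apply Rdiv_lt_0_compat; lra]|apply Rmin_l]. }
  assert (Hd2 : M * d <= eps).
  { apply Rle_trans with ((Rabs M + 1) * d).
    - apply Rmult_le_compat_r; [lra|]. generalize (Rle_abs M). lra.
    - apply Rle_trans with ((Rabs M + 1) * (eps / (Rabs M + 1))).
      + apply Rmult_le_compat_l; [lra|apply Rmin_r].
      + right. field. lra. }
  specialize (B d Hd).
  assert (S := RInt_kernel_im_shift a r (d ^ 2)
    ltac:(split; [apply pow_lt; lra|nra]) Hr).
  rewrite EJ in S. set (q := RInt _ (- r) r) in B, S.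
  replace (- PI * J + PI * s) with ((- PI * J - q) + (q + PI * s)) by ring.
  eapply Rle_trans; [apply Rabs_triang|]. lra. }
replace (- PI * J + PI * s) with (- PI * (J - s)) in L by ring.
rewrite Rabs_mult, Rabs_Ropp, (Rabs_right PI) in L by lra.
apply Rmult_le_reg_l with PI; [lra|]. replace (PI * (6 / r)) with (6 * PI / r) by (field; lra).
exact L.
Qed.

Lemma logistic_integral (a l : R) : a <> 0 ->
  is_RInt_gen (fun u => cauchy_density u / (1 + exp (a - u)))
    (Rbar_locally m_infty) (Rbar_locally p_infty) l ->
  l = / a + / (1 - exp a).
Proof.
intros Ha Hl.
apply (is_RInt_gen_symmetric_lim (fun u => cauchy_density u / (1 + exp (a - u)))) in Hl.
2:{ intros u. apply (continuous_mult cauchy_density).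
  - apply continuous_cauchy_density.
  - apply (ex_derive_continuous (fun u => / (1 + exp (a - u)))). auto_derive.
    generalize (exp_pos (a + - u)). lra. }
refine (filterlim_locally_unique _ _ _ Hl _).
apply filterlim_locally. intros eps.
exists (Rmax (Rabs a + 1) (6 / eps)). intros r Hr.
generalize (Rmax_l (Rabs a + 1) (6 / eps)), (Rmax_r (Rabs a + 1) (6 / eps)), (cond_pos eps), (Rabs_pos a).
intros H1 H2 H3 H4.
unfold ball; simpl; unfold AbsRing_ball, abs, minus, plus, opp; simpl.
eapply Rle_lt_trans; [apply RInt_logistic_estimate; lra|].
apply Rmult_lt_reg_r with r; [lra|]. unfold Rdiv at 1. rewrite Rmult_assoc, Rinv_l, Rmult_1_r by lra.
apply Rmult_lt_reg_l with (/ eps); [apply Rinv_0_lt_compat; lra|].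
rewrite <- Rmult_assoc, Rinv_l, Rmult_1_l by lra. unfold Rdiv in *. lra.
Qed.

(** * The moments and their generating function *)

Definition moment (n : nat) (u : R) : R := cauchy_density u * (exp u / (1 + exp u) ^ n).

(** With [T = 1 + exp u], this is [cauchy_density u * exp u] times the remainder of [1 / (T + x)]
    after [N] terms [(- x) ^ k / T ^ (k + 1)]. *)
Definition geometric_remainder (x : R) (N : nat) (u : R) : R :=
  cauchy_density u * ((- x) ^ N * (exp u / ((1 + exp u) ^ N * (1 + exp u + x)))).

Lemma moment_dominated (n : nat) (u : R) : (1 <= n)%nat ->
  Rabs (moment n u) <= 1 * cauchy_density u.
Proof.
intros Hn. unfold moment. rewrite Rabs_mult.
assert (HK := cauchy_density_pos u). assert (He := exp_pos u).
rewrite (Rabs_right (cauchy_density u)), Rmult_comm by lra. apply Rmult_le_compat_r; [lra|].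
assert (Hp : 1 + exp u <= (1 + exp u) ^ n).
{ rewrite <- (pow_1 (1 + exp u)) at 1. apply Rle_pow; [lra|exact Hn]. }
rewrite Rabs_right by (apply Rle_ge, Rdiv_le_0_compat; lra).
apply Rmult_le_reg_r with ((1 + exp u) ^ n); [lra|].
unfold Rdiv. rewrite Rmult_assoc, Rinv_l, Rmult_1_r by lra. lra.
Qed.

Lemma continuous_moment (n : nat) (u : R) : continuous (moment n) u.
Proof.
apply (continuous_mult cauchy_density); [apply continuous_cauchy_density|].
apply (ex_derive_continuous (fun u => exp u / (1 + exp u) ^ n)). auto_derive.
apply pow_nonzero. generalize (exp_pos u). lra.
Qed.

(** Since [x > -1], the denominator exceeds [exp u]. As the Cauchy density has mass 1, the
    integrated remainder is at most [Rabs x ^ N]. *)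
Lemma geometric_remainder_dominated (x : R) (N : nat) (u : R) : -1 < x ->
  Rabs (geometric_remainder x N u) <= Rabs x ^ N * cauchy_density u.
Proof.
intros Hx. unfold geometric_remainder. rewrite Rabs_mult.
assert (HK := cauchy_density_pos u). assert (He := exp_pos u).
rewrite (Rabs_right (cauchy_density u)), Rmult_comm by lra. apply Rmult_le_compat_r; [lra|].
rewrite Rabs_mult, <- RPow_abs, Rabs_Ropp. rewrite <- (Rmult_1_r (Rabs x ^ N)) at 2.
apply Rmult_le_compat_l; [apply pow_le, Rabs_pos|].
assert (Hp : 1 <= (1 + exp u) ^ N) by (apply pow_R1_Rle; lra).
assert (Hd : exp u < (1 + exp u) ^ N * (1 + exp u + x)) by nra.
rewrite Rabs_right by (apply Rle_ge, Rdiv_le_0_compat; lra).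
apply Rmult_le_reg_r with ((1 + exp u) ^ N * (1 + exp u + x)); [lra|].
unfold Rdiv. rewrite Rmult_assoc, Rinv_l, Rmult_1_r by lra. lra.
Qed.

Lemma continuous_geometric_remainder (x : R) (N : nat) (u : R) : -1 < x ->
  continuous (geometric_remainder x N) u.
Proof.
intros Hx. apply (continuous_mult cauchy_density); [apply continuous_cauchy_density|].
apply (ex_derive_continuous (fun u => (- x) ^ N * (exp u / ((1 + exp u) ^ N * (1 + exp u + x))))).
auto_derive. generalize (exp_pos u). intros.
apply Rmult_integral_contrapositive_currified; [apply pow_nonzero|]; lra.
Qed.

Lemma geometric_remainder_step (x : R) (N : nat) (u : R) : -1 < x ->
  (- x) ^ N * moment (S N) u + geometric_remainder x (S N) u = geometric_remainder x N u.
Proof.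
intros Hx. unfold moment, geometric_remainder. simpl. generalize (exp_pos u). intros.
assert ((1 + exp u) ^ N <> 0) by (apply pow_nonzero; lra). field. repeat split; lra.
Qed.

Lemma geometric_remainder_0 (x u : R) : -1 < x ->
  geometric_remainder x 0 u = cauchy_density u / (1 + exp (ln (1 + x) - u)).
Proof.
intros Hx. unfold geometric_remainder, Rminus. rewrite exp_plus, exp_ln, exp_Ropp by lra.
simpl. generalize (exp_pos u). intros. field. repeat split; lra.
Qed.

Definition moment_integral (n : nat) : R :=
  RInt_gen (moment n) (Rbar_locally m_infty) (Rbar_locally p_infty).

Lemma is_RInt_gen_moment (n : nat) : (1 <= n)%nat ->
  is_RInt_gen (moment n) (Rbar_locally m_infty) (Rbar_locally p_infty) (moment_integral n).
Proof.
intros Hn. apply (RInt_gen_correct (V := R_CompleteNormedModule)).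
destruct (is_RInt_gen_cauchy_dominated (moment n) 1 (continuous_moment n)
  (fun u => moment_dominated n u Hn)) as [l [Hl _]].
now exists l.
Qed.

Lemma moment_generating_series (x : R) : Rabs x < 1 -> x <> 0 ->
  is_series (fun k => (- x) ^ k * moment_integral (S k)) (/ ln (1 + x) - / x).
Proof.
intros Hx Hx0. assert (Hx1 : -1 < x) by (apply Rabs_def2 in Hx; lra).
assert (Ha : ln (1 + x) <> 0).
{ intros H. apply Hx0. assert (1 + x = 1); [|lra]. apply ln_inv; try lra. now rewrite ln_1. }
assert (P : forall N, exists l,
  is_RInt_gen (geometric_remainder x N) (Rbar_locally m_infty) (Rbar_locally p_infty) l /\
  Rabs l <= Rabs x ^ N).
{ intros N. apply is_RInt_gen_cauchy_dominated.
  - intros u. now apply continuous_geometric_remainder.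
  - intros u. now apply geometric_remainder_dominated. }
(* The expansion is integrated as an exact finite identity, so no limit is exchanged with the
   integral. [sum_n] up to [N] has [N + 1] terms, hence the remainder of index [S N]. *)
assert (Q : forall N l,
  is_RInt_gen (geometric_remainder x (S N)) (Rbar_locally m_infty) (Rbar_locally p_infty) l ->
  is_RInt_gen (geometric_remainder x 0) (Rbar_locally m_infty) (Rbar_locally p_infty)
    (sum_n (fun k => (- x) ^ k * moment_integral (S k)) N + l)).
{ assert (St : forall N l,
    is_RInt_gen (geometric_remainder x (S N)) (Rbar_locally m_infty) (Rbar_locally p_infty) l ->
    is_RInt_gen (geometric_remainder x N) (Rbar_locally m_infty) (Rbar_locally p_infty)
     ((- x) ^ N * moment_integral (S N) + l)).
  { intros N l Hl.
    assert (HN : (1 <= S N)%nat) by lia.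
    generalize (is_RInt_gen_plus _ _ _ _ (is_RInt_gen_scal _ ((- x) ^ N) _ (is_RInt_gen_moment (S N) HN)) Hl).
    apply is_RInt_gen_ext. apply filter_forall. intros ab u _.
    now apply geometric_remainder_step. }
  induction N as [|N IH]; intros l Hl.
  - rewrite sum_O. now apply St.
  - rewrite sum_Sn. unfold plus; simpl. rewrite Rplus_assoc. apply IH, St, Hl. }
destruct (P 0%nat) as [l [Hl _]].
assert (El : l = / ln (1 + x) - / x).
{ replace (/ ln (1 + x) - / x) with (/ ln (1 + x) + / (1 - exp (ln (1 + x)))).
  2:{ rewrite exp_ln by lra. field. repeat split; first [exact Ha | lra]. }
  apply logistic_integral; [exact Ha|].
  refine (is_RInt_gen_ext _ _ _ _ Hl). apply filter_forall. intros ab u _.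
  now apply geometric_remainder_0. }
rewrite <- El. apply filterlim_locally. intros eps.
destruct (pow_lt_1_zero (Rabs x) ltac:(now rewrite Rabs_Rabsolu) eps (cond_pos eps)) as [N0 HN0].
exists N0. intros N HN.
destruct (P (S N)) as [m [Hm Bm]]. specialize (Q N m Hm).
assert (U : l = sum_n (fun k => (- x) ^ k * moment_integral (S k)) N + m).
{ now rewrite <- (is_RInt_gen_unique _ _ Hl), <- (is_RInt_gen_unique _ _ Q). }
unfold ball; simpl; unfold AbsRing_ball, abs, minus, plus, opp; simpl.
rewrite U. set (s := sum_n _ N). replace (s + - (s + m)) with (- m) by ring.
rewrite Rabs_Ropp. eapply Rle_lt_trans; [exact Bm|].
specialize (HN0 (S N) ltac:(lia)). rewrite Rabs_right in HN0; [exact HN0|].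
apply Rle_ge, pow_le, Rabs_pos.
Qed.

Lemma is_bernoulli2_moments :
  is_bernoulli2 (fun n => match n with O => 1 | S k => (-1) ^ k * moment_integral (S k) end).
Proof.
exists (mkposreal 1 Rlt_0_1). intros x Hx.
assert (Hx' : Rabs x < 1).
{ revert Hx. unfold ball; simpl; unfold AbsRing_ball, abs, minus, plus, opp; simpl.
  now rewrite Ropp_0, Rplus_0_r. }
(* The constant coefficient 1 is split off; what remains is [x] times the moment series, because [x
   / ln (1 + x) - 1 = x * (1 / ln (1 + x) - 1 / x)]. *)
apply is_pseries_R. apply is_series_decr_1. unfold x_over_ln1p.
apply is_series_ext with (fun k => scal x ((- x) ^ k * moment_integral (S k))).
{ intros k. unfold scal; simpl; unfold mult; simpl.
  replace (- x) with (-1 * x) by ring. rewrite Rpow_mult_distr. ring. }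
destruct (Req_EM_T x 0) as [->|Nx].
- replace (plus _ _) with (scal 0 0 : R) by (unfold plus, opp, scal; simpl; unfold mult; simpl; ring).
  apply is_series_ext with (fun _ => 0).
  { intros k. unfold scal; simpl; unfold mult; simpl. ring. }
  apply filterlim_ext with (fun _ => 0).
  { intros k. rewrite sum_n_const. ring. }
  replace (scal 0 0 : R) with 0 by (unfold scal; simpl; unfold mult; simpl; ring).
  apply filterlim_const.
- assert (Ha : ln (1 + x) <> 0).
  { apply Rabs_def2 in Hx'. intros H. apply Nx. assert (1 + x = 1); [|lra].
    apply ln_inv; try lra. now rewrite ln_1. }
  replace (plus _ _) with (scal x (/ ln (1 + x) - / x) : R).
  2:{ unfold plus, opp, scal; simpl; unfold mult; simpl. field. now split. }
  apply (is_series_scal (V := R_NormedModule)). now apply moment_generating_series.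
Qed.

Theorem theorem1p1 (b : nat -> R) (hb : is_bernoulli2 b) (n : nat) (hn : (1 <= n)%nat) :
  let f := fun t : R => 1 / (((ln (t - 1)) ^ 2 + PI ^ 2) * t ^ n) in
  ex_RInt_gen f (at_right 1) (Rbar_locally p_infty) /\
  b n = (-1) ^ (n + 1) * RInt_gen f (at_right 1) (Rbar_locally p_infty).
Proof.
intros f.
assert (Hf : is_RInt_gen f (at_right 1) (Rbar_locally p_infty) (moment_integral n)).
{ apply is_RInt_gen_subst_exp.
  - intros t Ht. apply (ex_derive_continuous f). unfold f. auto_derive.
    assert (H := cauchy_denominator_pos (ln (t + - (1)))). simpl in H.
    repeat split; try lra.
    apply Rmult_integral_contrapositive_currified; [lra|apply pow_nonzero; lra].
  - refine (is_RInt_gen_ext _ _ _ _ (is_RInt_gen_moment n hn)).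
    apply filter_forall. intros ab u _. unfold f, moment, cauchy_density.
    replace (1 + exp u - 1) with (exp u) by ring. rewrite ln_exp.
    assert ((1 + exp u) ^ n <> 0) by (apply pow_nonzero; generalize (exp_pos u); lra).
    generalize (cauchy_denominator_pos u). intros. match goal with |- ?y = ?z => change (@eq R y z) end. field. split; [assumption|lra]. }
split; [now exists (moment_integral n)|].
rewrite (is_RInt_gen_unique f _ Hf), (bernoulli2_unique _ _ hb is_bernoulli2_moments n).
(* For [n = S k] the sign [(-1) ^ (n + 1)] has exponent [k + 2], so it agrees with the [(-1) ^ k] of
   the moment coefficients. *)
destruct n as [|k]; [lia|]. rewrite Nat.add_1_r. simpl. ring.
Qed.
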